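(* Let $n\ge 1$ and let $0<a_1<\cdots<a_n$ be integers whose subset sums $\sum_{i\in S}a_i$, $S\subseteq\{1,\dots,n\}$, are pairwise distinct. Then $$\operatorname{bw}(Q_n)\le a_n.$$ Consequently, $$f(n)\ \ge\ \operatorname{bw}(Q_n)=H_n,\qquad\text{where } H_n:=\sum_{j=0}^{n-1}\binom{j}{\lfloor j/2\rfloor}.$$
   Context: The hypercube $Q_n$ is the graph whose vertices are the subsets of $\{1,\dots,n\}$, two subsets being adjacent when they differ in exactly one element. A numbering of a finite graph $G=(V,E)$ with $m$ vertices is a bijection $\eta:V\to\{1,\dots,m\}$; its bandwidth is $\operatorname{bw}(\eta):=\max_{uv\in E}|\eta(u)-\eta(v)|$, and the bandwidth of $G$ is $\operatorname{bw}(G):=\min_\eta \operatorname{bw}(\eta)$, the minimum over all numberings. Define $f(n)$ as the minimum of the largest element over all $n$-element sets of positive integers whose $2^n$ subset sums are pairwise distinct. The equality $\operatorname{bw}(Q_n)=\sum_{j=0}^{n-1}\binom{j}{\lfloor j/2\rfloor}$ for every $n\ge1$ is a known theorem of Harper. *)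

(* Defs.v *)
From mathcomp Require Import all_boot all_order all_algebra.

Set Implicit Arguments.
Unset Strict Implicit.
Unset Printing Implicit Defensive.

Import IntDist.

(* A finite simple graph is given by its adjacency relation [e] on a finite
   type [T] of vertices. *)
Section Bandwidth.
Variables (T : finType) (e : rel T).

(* Labels are 0-based, in {0, ..., m - 1} with m = #|T|; the shift by one
   leaves all differences of labels unchanged. *)
Definition numbering (eta : {ffun T -> 'I_#|T|}) : bool := injectiveb eta.

Lemma numberingP (eta : {ffun T -> 'I_#|T|}) :
  reflect (bijective eta) (numbering eta).
Proof.
rewrite /numbering; apply: (iffP (injectiveP _)) => [inj_eta|]; last first.
  exact: bij_inj.
by apply: inj_card_bij; rewrite ?card_ord.
Qed.

Definition numbering_bandwidth (eta : {ffun T -> 'I_#|T|}) : nat :=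
  \max_(p : T * T | e p.1 p.2) `|eta p.1 - eta p.2|%N.

Definition enum_numbering : {ffun T -> 'I_#|T|} := [ffun x => enum_rank x].

Lemma enum_numberingP : numbering enum_numbering.
Proof.
by apply/injectiveP => x y; rewrite !ffunE; apply: enum_rank_inj.
Qed.

(* [enum_numbering] only witnesses that numberings exist; the value does not
   depend on it (see [bandwidthP]). *)
Definition bandwidth : nat :=
  numbering_bandwidth
    [arg min_(eta < enum_numbering | numbering eta) numbering_bandwidth eta].

Lemma bandwidthP :
  (exists2 eta, numbering eta & bandwidth = numbering_bandwidth eta) /\
  (forall eta, numbering eta -> bandwidth <= numbering_bandwidth eta).
Proof.
rewrite /bandwidth; case: arg_minnP => [|eta num_eta min_eta].
  exact: enum_numberingP.
by split; first by exists eta.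
Qed.

End Bandwidth.

(* The ground set {1, ..., n} is represented by 'I_n. *)
Definition hypercube (n : nat) : rel {set 'I_n} :=
  fun S S' => #|(S :\: S') :|: (S' :\: S)| == 1.

Definition distinct_subset_sums (m : nat) (A : {set 'I_m}) : bool :=
  dinjectiveb (fun S : {set 'I_m} => \sum_(x in S) (x : nat)) (mem (powerset A)).

(* Some n-element set of positive integers with pairwise distinct subset sums
   has largest element m; such a set is a subset of {0, ..., m}. *)
Definition dss_with_max (n m : nat) : bool :=
  [exists A : {set 'I_m.+1},
    [&& #|A| == n, ord0 \notin A, distinct_subset_sums A
      & \max_(x in A) x == m]].

Lemma sum_pow2_inj (n : nat) (b c : nat -> bool) :
  \sum_(i < n) b i * 2 ^ i = \sum_(i < n) c i * 2 ^ i ->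
  forall i, i < n -> b i = c i.
Proof.
elim: n b c => [|n IHn] b c; first by [].
have split_sum (d : nat -> bool) :
    \sum_(i < n.+1) d i * 2 ^ i = d 0 + (\sum_(i < n) d i.+1 * 2 ^ i).*2.
  rewrite big_ord_recl /= muln1 -muln2 big_distrl /=; congr (_ + _).
  by apply: eq_bigr => i _; rewrite /bump /= add1n expnSr mulnA.
rewrite !split_sum => eq_bc.
have eq0 : b 0 = c 0.
  by have := congr1 odd eq_bc; rewrite !oddD !odd_double !addbF !oddb.
move: eq_bc; rewrite eq0 => /addnI /double_inj /(IHn (b \o succn) (c \o succn)).
by move=> eqS [|i] //; apply: eqS.
Qed.

Lemma dss_with_max_ex (n : nat) : exists m, dss_with_max n m.
Proof.
pose m := \max_(i < n) 2 ^ i.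
have lem (i : 'I_n) : 2 ^ i < m.+1 by rewrite ltnS /m (leq_bigmax i).
pose g (i : 'I_n) : 'I_m.+1 := Ordinal (lem i).
have inj_g : injective g.
  by move=> i j /(congr1 val) /= /eqP; rewrite eqn_exp2l // => /eqP /val_inj.
exists m; apply/existsP; exists (g @: setT); apply/and4P; split.
- by rewrite card_imset // cardsT card_ord.
- apply/imsetP => -[i _ /(congr1 val) /= /esym /eqP].
  by rewrite expn_eq0.
- apply/dinjectiveP => S S'; rewrite !powersetE => sS sS' eqS.
  have sumE (U : {set 'I_m.+1}) : U \subset g @: setT ->
      \sum_(x in U) x = \sum_(i < n) (2 ^ i \in [seq val x | x in U]) * 2 ^ i.
    move=> sU; have -> : U = g @: (g @^-1: U).
      apply/setP => x; apply/idP/imsetP => [Ux|[i]]; last first.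
        by rewrite inE => Ui ->.
      by have /imsetP[i _ def_x] := subsetP sU _ Ux; exists i; rewrite // inE -def_x.
    rewrite big_imset /=; last by move=> i j _ _ /inj_g.
    rewrite big_mkcond; apply: eq_bigr => i _; rewrite inE.
    have -> : (2 ^ i \in [seq val x | x in g @: (g @^-1: U)]) = (g i \in U).
      rewrite -[2 ^ i]/(val (g i)) mem_image; last exact: val_inj.
      by rewrite mem_imset // inE.
    by case: (g i \in U); rewrite ?mul1n.
  move: eqS; rewrite !sumE // => /(@sum_pow2_inj n (fun i => 2 ^ i \in _)
    (fun i => 2 ^ i \in _)) eqb.
  apply/setP => x; have [/imsetP[i _ ->]|xA] := boolP (x \in g @: setT).
    have := eqb i (ltn_ord i).
    by rewrite -[2 ^ i]/(val (g i)) !mem_image //; apply: val_inj.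
  by rewrite (contraNF (subsetP sS x)) // (contraNF (subsetP sS' x)).
- by rewrite big_imset //= => [|i j _ _ /inj_g //]; apply/eqP/eq_bigl => i; rewrite inE.
Qed.

Definition dss_min_max (n : nat) : nat := ex_minn (dss_with_max_ex n).

Definition harper_sum (n : nat) : nat := \sum_(j < n) 'C(j, j./2).

(* Main.v *)
Require Import Defs.
From mathcomp Require Import all_boot all_order all_algebra.
From mathcomp Require Import zify.

(* Any injective integer labelling of the vertices in which adjacent labels
   differ by at most m can be compressed to a numbering without increasing
   differences, so it bounds the bandwidth by m. Subset sums are such a
   labelling with m = a_n.
   The same principle gives bw(Q_n) <= H_n: number S by the sum over m < n of
   bin_tail m #|S :&: {0, ..., m}|; adding an element to S changes the m-th
   term by at most a single binomial coefficient 'C(m, _).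
   For the lower bound, splitting Q_(n+1) into two copies of Q_n shows that
   closed neighbourhoods satisfy
   |N[S]| >= max(|N[S0]|, |S1|) + max(|N[S1]|, |S0|),
   so Harper's vertex-isoperimetric inequality follows by induction from an
   arithmetic property of its extremal function. The latter reduces to
   inequalities for the Kruskal-Katona function, proved along its recursion.
   Applied to the vertices with the first k labels, for a suitable k, it gives
   a vertex of N[S] whose label exceeds those of S by at least H_n. *)

(** * The Kruskal-Katona function *)

(* For z <= 'C(n, k), [shadow n k z] is the size of the lower shadow of the
   first z k-subsets of {1, ..., n} in the colexicographic order; the first
   'C(n', k) of them avoid the last element. *)
Fixpoint shadow (n k z : nat) : nat :=
  match n, k with
  | n'.+1, k'.+1 =>
    if z <= 'C(n', k) then shadow n' k z
    else 'C(n', k') + shadow n' k' (z - 'C(n', k))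
  | _, _ => 0
  end.

Lemma shadow0k n z : shadow n 0 z = 0.
Proof. by case: n. Qed.

Lemma shadow0 n k : shadow n k 0 = 0.
Proof. by elim: n k => [|n IHn] [|k] //=. Qed.

Lemma shadow_left n k z : z <= 'C(n, k) -> shadow n.+1 k z = shadow n k z.
Proof. by case: k => [|k] le_z; [rewrite !shadow0k | rewrite /= le_z]. Qed.

Lemma shadow_right n k z : 0 < z ->
  shadow n.+1 k.+1 ('C(n, k.+1) + z) = 'C(n, k) + shadow n k z.
Proof. by move=> z_gt0; rewrite /= leqNgt -{1}[X in X < _]addn0 ltn_add2l z_gt0 addKn. Qed.

Variant bin_split n k z : Prop :=
  | BinLeft of z <= 'C(n, k.+1)
  | BinRight z' of 0 < z' & z' <= 'C(n, k) & z = 'C(n, k.+1) + z'.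

Lemma bin_splitP n k z : z <= 'C(n.+1, k.+1) -> bin_split n k z.
Proof.
rewrite binS => le_z; have [|lt_z] := leqP z 'C(n, k.+1); first exact: BinLeft.
by apply: (@BinRight _ _ _ (z - 'C(n, k.+1))); lia.
Qed.

Lemma shadow_le n k z : z <= 'C(n, k.+1) -> shadow n k.+1 z <= 'C(n, k).
Proof.
elim: n k z => [//|n IHn] k z /bin_splitP[le_z|z' z'_gt0 le_z' ->].
  rewrite shadow_left // (leq_trans (IHn _ _ le_z)) //.
  by case: k {le_z} => [|k]; rewrite ?bin0 // binS leq_addr.
rewrite shadow_right //; case: k le_z' => [|k] le_z'; first by rewrite shadow0k !bin0.
by rewrite binS leq_add2l IHn.
Qed.

Lemma shadow_full n k : k < n -> shadow n k.+1 'C(n, k.+1) = 'C(n, k).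
Proof.
elim: n k => [//|n IHn] k lt_kn; rewrite {1}binS shadow_right ?bin_gt0 //.
by case: k lt_kn => [|k] lt_kn; rewrite ?shadow0k ?bin0 // IHn ?binS //.
Qed.

(** At [z = 0] the recursion takes its left branch, so only an inequality survives there. *)
Lemma shadow_right_le n k z :
  shadow n.+1 k.+1 ('C(n, k.+1) + z) <= 'C(n, k) + shadow n k z.
Proof.
case: z => [|z]; last by rewrite shadow_right.
by rewrite addn0 shadow_left // (leq_trans (shadow_le _ _ _ _)) ?leq_addr.
Qed.

Lemma shadow_mono n k z w :
  z <= w -> w <= 'C(n, k) -> shadow n k z <= shadow n k w.
Proof.
elim: n k z w => [//|n IHn] [|k] z w le_zw; first by [].
case/bin_splitP => [le_w|w' w'_gt0 le_w' eq_w].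
  by rewrite !shadow_left ?IHn // (leq_trans le_zw).
rewrite eq_w shadow_right //.
have /bin_splitP[le_z|z' z'_gt0 le_z' eq_z] : z <= 'C(n.+1, k.+1) by rewrite binS; lia.
  by rewrite shadow_left // (leq_trans (shadow_le _ _ _ le_z)) ?leq_addr.
by rewrite eq_z shadow_right // leq_add2l IHn //; lia.
Qed.

Lemma shadow_stable m n k z : m <= n -> z <= 'C(m, k) -> shadow n k z = shadow m k z.
Proof.
move=> /subnK <-; elim: (n - m) => [//|d IHd] le_z.
rewrite addSn shadow_left ?IHd // (leq_trans le_z) //.
exact/leq_bin2l/leq_addl.
Qed.

Lemma shadow_gt0 n k z : 0 < z -> z <= 'C(n, k.+1) -> 0 < shadow n k.+1 z.
Proof.
elim: n k z => [|n IHn] k z z_gt0; first by rewrite bin0n; lia.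
case/bin_splitP => [le_z|z' z'_gt0 le_z' ->].
  by rewrite shadow_left // IHn.
by rewrite shadow_right // ltn_addr // (leq_trans z'_gt0).
Qed.

(* The complements of the sets outside the shadow form an initial family whose
   shadow avoids the complements of the original sets. *)
Lemma shadow_dual n k l z j :
    k + l = n.+1 -> z <= 'C(n, k) -> j <= 'C(n, l) ->
  shadow n k z + j <= 'C(n, l) -> shadow n l j + z <= 'C(n, k).
Proof.
elim: n k l z j => [//|n IHn] [|k] [|l] z j eq_kl le_z le_j; rewrite ?shadow0k //.
  by move: le_j; rewrite bin_small -?eq_kl // leqn0 => /eqP->; rewrite shadow0.
have eqC : 'C(n, k) = 'C(n, l) by rewrite -bin_sub; [congr 'C(_, _)|]; lia.
case/bin_splitP: le_z => [le_z|z' z'_gt0 le_z' ->];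
  case/bin_splitP: le_j => [le_j|j' j'_gt0 le_j' ->];
  rewrite ?(shadow_left _ _ _ le_z) ?(shadow_left _ _ _ le_j) ?shadow_right // !binS => le_s.
- by have := shadow_le _ _ _ le_j; lia.
- have := IHn k.+1 l z j'; lia.
- have := IHn k l.+1 z' j; lia.
- lia.
Qed.

(** * Subadditivity of the shadow and its dual form *)

Definition shadow_subadditive n k := forall x y,
  x + y <= 'C(n, k) -> shadow n k (x + y) <= shadow n k x + shadow n k y.

(** Induction on a ground size [m] in which [z] fits. In the right branch subadditivity splits [z],
    and the part ['C(m, k.+1)] is bounded through the induction hypothesis and [shadow_le] by the
    ['C(m, k)] of the recursion. *)
Lemma shadow_leS n k z : shadow_subadditive n k ->
  z <= 'C(n, k) -> z <= 'C(n, k.+1) -> shadow n k z <= shadow n k.+1 z.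
Proof.
move=> subadd le_z; suff: forall m, m <= n -> z <= 'C(m, k.+1) ->
  shadow n k z <= shadow m k.+1 z by apply.
move=> m; elim: m z le_z => [|m IHm] z le_z le_mn.
  by rewrite bin0n leqn0 => /eqP->; rewrite shadow0.
case/bin_splitP => [le_zm|z' z'_gt0 le_z' eq_z].
  by rewrite (@shadow_left m) // IHm // ltnW.
rewrite eq_z shadow_right //; move: le_z; rewrite eq_z => le_z.
rewrite (leq_trans (subadd _ _ le_z)) // (@shadow_stable m n k z') ?(ltnW le_mn) //.
rewrite leq_add2r (leq_trans (IHm _ _ _ _)) ?shadow_le ?(ltnW le_mn) //.
by rewrite (leq_trans _ le_z) ?leq_addr.
Qed.

Definition shadow_sub_full n k := forall x y z,
  x <= 'C(n, k.+1) -> y <= 'C(n, k.+1) -> x + y = 'C(n, k.+1) + z ->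
  'C(n, k) + shadow n k.+1 z <= shadow n k.+1 x + shadow n k.+1 y.

(* This is the subadditivity of [shadow n (n - k)], read through [shadow_dual]. *)
Lemma shadow_sub_fullP n : (forall k, shadow_subadditive n k) ->
  forall k, k < n -> shadow_sub_full n k.
Proof.
move=> subadd k lt_kn x y z le_x le_y eq_xy.
have [z0|z_gt0] := posnP z.
  rewrite z0 shadow0 addn0 -(shadow_full _ _ lt_kn).
  by have:= subadd k.+1 x y; rewrite eq_xy z0 addn0; apply.
have eqC : 'C(n, k) = 'C(n, n - k) by rewrite bin_sub // ltnW.
have eq_kl : k.+1 + (n - k) = n.+1 by lia.
have sx := shadow_le _ _ _ le_x; have sy := shadow_le _ _ _ le_y.
have dual w : w <= 'C(n, k.+1) ->
    shadow n (n - k) ('C(n, k) - shadow n k.+1 w) + w <= 'C(n, k.+1).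
  move=> le_w; have := shadow_le _ _ _ le_w.
  by move=> sw; apply: shadow_dual eq_kl _ _ _; lia.
have := dual _ le_y; have := dual _ le_x.
move: (shadow n k.+1 x) (shadow n k.+1 y) sx sy => sx sy le_sx le_sy dx dy.
have [le_s|lt_s] := leqP (('C(n, k) - sx) + ('C(n, k) - sy)) 'C(n, k).
  have := subadd (n - k) _ _ (leq_trans le_s (eq_leq eqC)).
  move=> sub_xy.
  have := @shadow_dual n (n - k) k.+1 (('C(n, k) - sx) + ('C(n, k) - sy)) z.
  by rewrite -eqC; lia.
(* This case cannot occur: [sx] is less than the dual count of [y], so subadditivity at ['C(n, k)]
   and [dual] would give [x + y <= 'C(n, k.+1)], against [0 < z]. *)
have := subadd (n - k) ('C(n, k) - sx) sx.
rewrite subnK // -{1}eqC leqnn => /(_ isT).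
have -> : shadow n (n - k) 'C(n, k) = 'C(n, k.+1).
  rewrite eqC; have -> : n - k = (n - k.+1).+1 by lia.
  by rewrite shadow_full ?bin_sub //; lia.
have := @shadow_mono n (n - k) sx ('C(n, k) - sy); lia.
Qed.

(** When both summands avoid the last element but their sum does not, the dual form for [n] applies.
    The inner induction on [k] provides [shadow_leS] at [n.+1], needed when [x] alone passes
    ['C(n, k.+1)]. *)
Lemma shadowD n k : shadow_subadditive n k.
Proof.
elim: n k => [|n IHn] k; first by case: k.
elim: k => [|k IHk] x y; first by rewrite !shadow0k.
wlog le_yx: x y / y <= x.
  by move=> W; case: (leqP y x) => [/W//|/ltnW/W]; rewrite [y + x]addnC [_ y + _]addnC.
case/bin_splitP => [le_xy|z z_gt0 le_z eq_xy].
  rewrite !shadow_left ?IHn //; lia.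
have [le_x|lt_x] := leqP x 'C(n, k.+1).
  rewrite eq_xy shadow_right // (@shadow_left _ _ x) //.
  rewrite (@shadow_left _ _ y) ?(leq_trans le_yx) //.
  apply: leq_trans (shadow_sub_fullP _ IHn _ _ _ _ z _ _ _) => //.
  - rewrite leq_add2l shadow_leS //; lia.
  - by rewrite ltnNge; apply/negP=> le_nk; have := bin_small (n := n) (m := k.+1); lia.
  - lia.
have [x' eq_x] : exists x', x = 'C(n, k.+1) + x' by exists (x - 'C(n, k.+1)); lia.
have eq_z : z = x' + y by lia.
rewrite eq_xy eq_x !shadow_right //; last by lia.
have le_yk : y <= 'C(n, k) by lia.
have leS : shadow n k y <= shadow n.+1 k.+1 y.
  rewrite -(@shadow_left n k y) // shadow_leS //; last by rewrite binS; lia.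
  by case: k {IHk eq_x eq_xy lt_x le_z} le_yk => [|k]; rewrite ?bin0 // binS; lia.
have := IHn k x' y; rewrite -eq_z; lia.
Qed.

(* The Eckhoff-Wegner inequality, in the two cases for the maximum. *)
Lemma shadow_EckhoffWegner_le n k x y :
    x <= 'C(n, k) -> y <= 'C(n, k.+1) -> x <= shadow n k.+1 y ->
  shadow n.+1 k.+1 (x + y) <= shadow n k x + shadow n k.+1 y.
Proof.
elim: n k x y => [|n IHn] k x y.
  rewrite [in 'C(0, k.+1)]bin0n !leqn0 => _ /eqP-> /eqP->.
  by rewrite shadow0.
case: k => [|k].
  rewrite bin0 shadow0k => le_x le_y lex.
  have [y0|y_gt0] := posnP y.
    by move: lex; rewrite y0 shadow0 leqn0 => /eqP->; rewrite shadow0.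
  have sy := shadow_gt0 _ _ _ y_gt0 le_y.
  rewrite add0n (leq_trans _ sy) // (leq_trans (shadow_le _ _ _ _)) ?bin0 //.
  by move: le_y; rewrite !bin1; lia.
case/bin_splitP => [le_x|x' x'_gt0 le_x' ->];
  case/bin_splitP => [le_y|y' y'_gt0 le_y' ->]; rewrite ?shadow_right //.
- rewrite (shadow_left _ _ _ le_x) (shadow_left _ _ _ le_y) => lexy.
  by rewrite shadow_left ?IHn // binS; lia.
- move=> _; rewrite (shadow_left _ _ _ le_x) addnCA.
  have [le_xy|lt_xy] := leqP (x + y') 'C(n, k.+1).
    rewrite shadow_left ?binS ?leq_add2l // shadow_right; last by lia.
    by rewrite addnCA leq_add2l shadowD.
  have [z eq_z] : exists z, x + y' = 'C(n, k.+1) + z by exists (x + y' - 'C(n, k.+1)); lia.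
  rewrite eq_z addnA -binS shadow_right; last by lia.
  rewrite shadow_left; last by lia.
  rewrite (binS n k).
  have := shadow_sub_fullP _ (shadowD n) k _ x y' z le_x le_y' eq_z.
  have : k < n by rewrite ltnNge; apply/negP=> le_nk; have := bin_small (n := n) (m := k.+1); lia.
  move=> -> /(_ isT); lia.
- by rewrite (shadow_left _ _ _ le_y); have := shadow_le _ _ _ le_y; lia.
- rewrite leq_add2l => lexy.
  have -> : 'C(n, k.+1) + x' + ('C(n, k.+2) + y') = 'C(n.+1, k.+2) + (x' + y').
    by rewrite binS; lia.
  rewrite shadow_right ?(binS n k); last by lia.
  have := IHn k x' y' le_x' le_y' lexy; lia.
Qed.

Lemma shadow_EckhoffWegner_ge n k x y :
    x <= 'C(n, k) -> y <= 'C(n, k.+1) -> shadow n k.+1 y <= x ->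
  shadow n.+1 k.+1 (x + y) <= shadow n k x + x.
Proof.
have case0 m x' y' : x' <= 'C(m, 0) -> y' <= 'C(m, 1) -> shadow m 1 y' <= x' ->
    shadow m.+1 1 (x' + y') <= shadow m 0 x' + x'.
  rewrite bin0 shadow0k add0n => le_x le_y.
  have [y0|y_gt0] := posnP y'; last first.
    move=> /(leq_trans (shadow_gt0 _ _ _ y_gt0 le_y)) x_gt0.
    rewrite (leq_trans _ x_gt0) // (leq_trans (shadow_le _ _ _ _)) ?bin0 //.
    by move: le_y; rewrite !bin1; lia.
  rewrite y0 addn0 => _; case: x' le_x => [|[]] // _; rewrite ?shadow0 //.
  by rewrite (leq_trans (shadow_le _ _ _ _)) ?bin0 ?bin1.
elim: n k x y => [|n IHn] [|k] x y; try exact: case0.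
  by rewrite !bin0n !leqn0 => /eqP-> /eqP->; rewrite shadow0.
case/bin_splitP => [le_x|x' x'_gt0 le_x' ->];
  case/bin_splitP => [le_y|y' y'_gt0 le_y' ->]; rewrite ?shadow_right //.
- rewrite (shadow_left _ _ _ le_x) (shadow_left _ _ _ le_y) => lexy.
  by rewrite shadow_left ?IHn // binS; lia.
- by have := shadow_gt0 _ _ _ y'_gt0 le_y'; lia.
(* Raising [y] to ['C(n, k.+2)] completes a full level, which the recursion peels off; the
   inequality for [x'] and [0] remains. *)
- move=> _; apply: leq_trans (shadow_mono _ _ _ ('C(n.+1, k.+2) + x') _ _) _.
  + by rewrite binS; lia.
  + by rewrite (binS n.+1) leq_add2l binS; lia.
  rewrite shadow_right //; have := IHn k x' 0; rewrite shadow0 addn0 binS; lia.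
- have -> : 'C(n, k.+1) + x' + ('C(n, k.+2) + y') = 'C(n.+1, k.+2) + (x' + y').
    by rewrite binS; lia.
  move=> lexy; rewrite shadow_right ?binS; last by lia.
  have := IHn k x' y'; lia.
Qed.

Lemma shadow_EckhoffWegner n k x y : x <= 'C(n, k) -> y <= 'C(n, k.+1) ->
  shadow n.+1 k.+1 (x + y) <= shadow n k x + maxn (shadow n k.+1 y) x.
Proof.
move=> le_x le_y; have [/ltnW le_s|le_s] := ltnP x (shadow n k.+1 y).
  exact: shadow_EckhoffWegner_le.
exact: shadow_EckhoffWegner_ge.
Qed.

(** * The extremal function of Harper's theorem *)

(** For [k <= n], the size of a Hamming ball of radius [n - k] in the hypercube. *)
Definition bin_tail (n k : nat) : nat := \sum_(k <= i < n.+1) 'C(n, i).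

Lemma bin_tailS n k : bin_tail n k = 'C(n, k) + bin_tail n k.+1.
Proof.
rewrite /bin_tail; have [le_kn|lt_nk] := leqP k n; first by rewrite big_ltn.
by rewrite bin_small // !big_geq // ltnS ltnW.
Qed.

Lemma bin_tail_small n k : n < k -> bin_tail n k = 0.
Proof. by move=> lt_nk; rewrite /bin_tail big_geq. Qed.

Lemma bin_tail_pascal n k : bin_tail n.+1 k.+1 = bin_tail n k + bin_tail n k.+1.
Proof.
rewrite /bin_tail big_add1 /=.
rewrite (eq_bigr (fun i => 'C(n, i.+1) + 'C(n, i))) => [|i _]; last by rewrite binS.
rewrite big_split /= addnC; congr (_ + _).
have [le_kn|lt_nk] := leqP k n; last by rewrite !big_geq // ltnS ltnW.
transitivity (\sum_(k.+1 <= i < n.+2) 'C(n, i)); first by rewrite big_add1.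
by rewrite big_nat_recr //= bin_small ?addn0.
Qed.

Lemma bin_tail0 n : bin_tail n 0 = 2 ^ n.
Proof.
rewrite /bin_tail big_mkord -[2]/(1 + 1) expnDn.
by apply: eq_bigr => i _; rewrite !exp1n !muln1.
Qed.

Lemma leq_bin_tail n k l : k <= l -> bin_tail n l <= bin_tail n k.
Proof.
move=> /subnK <-; elim: (l - k) => [//|d IHd].
by rewrite addSn (leq_trans _ IHd) // [X in _ <= X]bin_tailS leq_addl.
Qed.

(* The size of the closed neighbourhood of an extremal set of
   [bin_tail n k.+1 + z] vertices of Q_n: all sets of size less than n - k,
   and z sets of size n - k; [shadow] sees their complements. For the empty
   vertex set (k = n, z = 0) the value is 1 instead of 0. *)
Definition nbhd_bound (n k z : nat) : nat := bin_tail n k + shadow n k z.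

(** The smallest Hamming ball with at least [s] vertices determines [k]. *)
Lemma bin_tail_rep n s : s <= 2 ^ n ->
  exists k z, [/\ k <= n, z <= 'C(n, k) & s = bin_tail n k.+1 + z].
Proof.
rewrite -bin_tail0 => le_s.
have: exists k, s <= bin_tail n (n - k) by exists n; rewrite subnn.
case: (ex_minnP (P := fun k => s <= bin_tail n (n - k))) => [|k le_sk min_k _].
  by exists n; rewrite subnn.
have le_kn : k <= n by apply: min_k; rewrite subnn.
exists (n - k), (s - bin_tail n (n - k).+1).
rewrite leq_subr leq_subLR -{1}[_ + _]addnC -bin_tailS le_sk.
split=> //; rewrite subnKC //.
case: k le_kn le_sk min_k => [|k] le_kn le_sk min_k; first by rewrite subn0 bin_tail_small.
rewrite leqNgt; apply/negP => lt_s.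
suff /min_k : s <= bin_tail n (n - k) by rewrite ltnn.
by rewrite -subnSK // ltnW.
Qed.

(** A cardinality between two levels has two representations, [z = 0] and [w = 'C(n, l)] with
    [l = k.+1]. Their values agree by [shadow_full], so the bound depends on the cardinality
    alone. *)
Lemma nbhd_bound_mono n k l z w :
    k <= n -> l <= n -> z <= 'C(n, k) -> w <= 'C(n, l) ->
    bin_tail n k.+1 + z <= bin_tail n l.+1 + w ->
  nbhd_bound n k z <= nbhd_bound n l w.
Proof.
rewrite /nbhd_bound => le_kn le_ln le_z le_w; case: (ltngtP k l) => [lt_kl|lt_lk|eq_kl].
- rewrite [in X in _ <= X -> _]addnC.
  have := leq_bin_tail n _ _ lt_kl; rewrite (bin_tailS n l) => le_kl le_s.
  have {}le_w : w = 'C(n, l) by lia.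
  have z0 : z = 0 by lia.
  have eq_l : l = k.+1.
    apply/eqP; rewrite eqn_leq lt_kl andbT leqNgt; apply/negP => lt_k2l.
    have := leq_bin_tail n _ _ lt_k2l; rewrite (bin_tailS n l).
    have := bin_tailS n k.+1; have : 0 < 'C(n, k.+1) by rewrite bin_gt0 (leq_trans lt_kl).
    lia.
  rewrite z0 le_w eq_l shadow0 shadow_full -?eq_l // addn0 addnC bin_tailS -eq_l.
  by rewrite bin_tailS.
- case: k le_kn le_z lt_lk => [//|k] le_kn le_z lt_lk _.
  apply: leq_trans (_ : bin_tail n k <= _).
    by rewrite [X in _ <= X]bin_tailS addnC leq_add2r shadow_le.
  by rewrite (leq_trans (leq_bin_tail n l k lt_lk)) ?leq_addr.
- by rewrite -eq_kl in le_w *; rewrite !leq_add2l => le_zw; apply: shadow_mono.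
Qed.

(** By Pascal's rule the sum falls on level [k.+1] or [k]; the two cases are subadditivity and its
    dual form. *)
Lemma nbhd_bound_double n k x y : k <= n -> x <= 'C(n, k) -> y <= 'C(n, k) ->
  exists l z, [/\ l <= n.+1, z <= 'C(n.+1, l),
    (bin_tail n k.+1 + x) + (bin_tail n k.+1 + y) = bin_tail n.+1 l.+1 + z &
    nbhd_bound n.+1 l z <= nbhd_bound n k x + nbhd_bound n k y].
Proof.
move=> le_kn le_x le_y; rewrite /nbhd_bound.
have [le_xy|lt_xy] := leqP (x + y) 'C(n, k).
  exists k.+1, ('C(n, k.+1) + (x + y)); split=> //.
  - by rewrite binS; lia.
  - by rewrite bin_tail_pascal (bin_tailS n k.+1); lia.
  - have := shadow_right_le n k (x + y); have := shadowD _ _ _ _ le_xy.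
    by rewrite bin_tail_pascal (bin_tailS n k); lia.
exists k, (x + y - 'C(n, k)); split.
- exact: leqW.
- by rewrite (leq_trans _ (leq_bin2l _ (leqnSn n))) //; lia.
- by rewrite bin_tail_pascal (bin_tailS n k); lia.
case: k le_kn le_x le_y lt_xy => [|k] le_kn le_x le_y lt_xy.
  by rewrite !shadow0k !bin_tail0 expnS; lia.
rewrite shadow_left; last by lia.
have := shadow_sub_fullP _ (shadowD n) _ le_kn x y (x + y - 'C(n, k.+1)) le_x le_y.
rewrite bin_tail_pascal (bin_tailS n k); lia.
Qed.

(** The arithmetic of the isoperimetric induction, [p] and [q] being the sizes of the two halves.
    Consecutive levels need the Eckhoff-Wegner inequality, equal levels [nbhd_bound_double]. *)
Lemma nbhd_bound_split n k0 x k1 y k z :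
    k0 <= n -> x <= 'C(n, k0) -> k1 <= n -> y <= 'C(n, k1) ->
    k <= n.+1 -> z <= 'C(n.+1, k) ->
    let p := bin_tail n k0.+1 + x in let q := bin_tail n k1.+1 + y in
    q <= p -> bin_tail n.+1 k.+1 + z = p + q ->
  nbhd_bound n.+1 k z <= nbhd_bound n k0 x + maxn (nbhd_bound n k1 y) p.
Proof.
move=> le_k0 le_x le_k1 le_y le_k le_z p q le_qp eq_pq.
(* By monotonicity [p + q] may be rounded up to a convenient size. *)
suff [l [w [le_l le_w le_s le_b]]] : exists l w, [/\ l <= n.+1, w <= 'C(n.+1, l),
    p + q <= bin_tail n.+1 l.+1 + w &
    nbhd_bound n.+1 l w <= nbhd_bound n k0 x + maxn (nbhd_bound n k1 y) p].
  by apply: leq_trans le_b; apply: nbhd_bound_mono => //; rewrite eq_pq.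
have [lt_k01|] := ltnP k0 k1; last rewrite leq_eqVlt => /predU1P[eq_k|lt_k10].
- have fit w : w <= 'C(n, k0.+1) -> k0.+1 <= n.+1 /\ x + w <= 'C(n.+1, k0.+1).
    by rewrite binS; split=> //; lia.
  have bound w : w <= 'C(n, k0.+1) -> bin_tail n k0.+1 + shadow n k0.+1 w
      <= maxn (nbhd_bound n k1 y) p ->
      nbhd_bound n.+1 k0.+1 (x + w) <= nbhd_bound n k0 x + maxn (nbhd_bound n k1 y) p.
    move=> le_w; have := leq_maxr (nbhd_bound n k1 y) p.
    move: (maxn _ p) => M le_pM le_wM; have := shadow_EckhoffWegner _ _ _ _ le_x le_w.
    by rewrite /nbhd_bound bin_tail_pascal; lia.
  move: lt_k01; rewrite leq_eqVlt => /predU1P[eq_k|lt_k].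
    rewrite -{}eq_k in le_y q le_qp eq_pq bound *.
    exists k0.+1, (x + y); case: (fit y le_y) => le1 le2; split=> //.
      by rewrite /p /q bin_tail_pascal; lia.
    by apply: bound => //; rewrite leq_max leqnn.
  (* Here [q] is rounded up to the ball size [bin_tail n k0.+2], whose neighbourhood bound
     [bin_tail n k0.+1] is still at most [p]. *)
  exists k0.+1, (x + 0); case: (fit 0 (leq0n _)) => le1 le2; split=> //.
    have := leq_bin_tail n _ _ lt_k; rewrite (bin_tailS n k1) /p /q bin_tail_pascal.
    lia.
  by apply: bound => //; rewrite shadow0 leq_max /p addn0 leq_addr orbT.
- rewrite -{}eq_k in le_x p le_qp eq_pq *.
  have [l [w [le_l le_w eq_s le_b]]] := nbhd_bound_double _ _ _ _ le_k1 le_x le_y.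
  exists l, w; rewrite eq_s leqnn; split=> //.
  by rewrite (leq_trans le_b) // leq_add2l leq_maxl.
(* Together with [q <= p] the levels force [p = q], so [y] can replace [x]. *)
- have le_b : nbhd_bound n k1 y <= nbhd_bound n k0 x by apply: nbhd_bound_mono.
  have [l [w [le_l le_w eq_s le_lw]]] := nbhd_bound_double _ _ _ _ le_k1 le_y le_y.
  exists l, w; split=> //; last exact: leq_trans le_lw (leq_add le_b (leq_maxl _ _)).
  rewrite -eq_s leq_add2r /p.
  have := leq_bin_tail n _ _ lt_k10; rewrite (bin_tailS n k0); lia.
Qed.

(** * The vertex-isoperimetric inequality on bit vectors *)

Fixpoint cube (n : nat) : seq bitseq :=
  if n is n'.+1 then map (cons false) (cube n') ++ map (cons true) (cube n')
  else [:: [::]].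

(* The closed neighbourhood of P in the graph of bit flips. *)
Fixpoint nbhd (P : pred bitseq) (s : bitseq) : bool :=
  if s is b :: s' then nbhd (fun t => P (b :: t)) s' || P (~~ b :: s') else P [::].

Lemma size_cube n : size (cube n) = 2 ^ n.
Proof. by elim: n => [//|n IHn]; rewrite /= size_cat !size_map IHn expnS; lia. Qed.

Lemma count_cubeS (P : pred bitseq) n : count P (cube n.+1) =
  count (fun t => P (false :: t)) (cube n) + count (fun t => P (true :: t)) (cube n).
Proof. by rewrite /= count_cat !count_map. Qed.

Lemma cube_isoperimetry n (P : pred bitseq) k z :
    k <= n -> z <= 'C(n, k) -> 0 < count P (cube n) ->
    count P (cube n) = bin_tail n k.+1 + z ->
  nbhd_bound n k z <= count (nbhd P) (cube n).
Proof.
elim: n P k z => [|n IHn] P k z.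
  rewrite leqn0 => /eqP-> _ /=.
  by case: (P [::]) => // _ _; rewrite /nbhd_bound bin_tail0 shadow0k.
move=> le_k le_z; rewrite !count_cubeS /=.
(* Independent predicates for the two halves make the claim symmetric, so the larger half can come
   first. *)
suff step (P0 P1 : pred bitseq) :
    0 < count P0 (cube n) + count P1 (cube n) ->
    count P0 (cube n) + count P1 (cube n) = bin_tail n.+1 k.+1 + z ->
    nbhd_bound n.+1 k z <= count (fun t => nbhd P0 t || P1 t) (cube n)
                         + count (fun t => nbhd P1 t || P0 t) (cube n).
  exact: step.
wlog le10 : P0 P1 / count P1 (cube n) <= count P0 (cube n).
  move=> W; have [/W//|/ltnW le01] := leqP (count P1 (cube n)) (count P0 (cube n)).
  by rewrite addnC => gt0 eq_z; rewrite addnC; apply: W => //; rewrite addnC.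
have bound Q0 Q1 l w : l <= n -> w <= 'C(n, l) -> 0 < count Q0 (cube n) ->
    count Q0 (cube n) = bin_tail n l.+1 + w ->
    maxn (nbhd_bound n l w) (count Q1 (cube n))
    <= count (fun t => nbhd Q0 t || Q1 t) (cube n).
  move=> le_l le_w gt0 eqQ; rewrite geq_max; apply/andP; split.
    by apply: leq_trans (IHn _ _ _ le_l le_w gt0 eqQ) _; apply: sub_count => t /= ->.
  by apply: sub_count => t /= ->; rewrite orbT.
have le_count Q : count Q (cube n) <= 2 ^ n by rewrite -size_cube count_size.
move=> gt0 eq_z; have {}gt0 : 0 < count P0 (cube n) by lia.
have [k0 [x [le_k0 le_x eq_x]]] := bin_tail_rep _ _ (le_count P0).
have [k1 [y [le_k1 le_y eq_y]]] := bin_tail_rep _ _ (le_count P1).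
apply: leq_trans (_ : nbhd_bound n k0 x + maxn (nbhd_bound n k1 y) (count P0 (cube n)) <= _).
  by rewrite eq_x; apply: nbhd_bound_split; rewrite // -?eq_x -?eq_y.
apply: leq_add.
  by have := bound P0 P1 _ _ le_k0 le_x gt0 eq_x; rewrite geq_max => /andP[].
(* For an empty half [nbhd_bound] is 1, which the positive size of the other half absorbs in the
   maximum. *)
have [q0|q_gt0] := posnP (count P1 (cube n)); last exact: bound.
have [eq_k1 y0] : k1 = n /\ y = 0.
  split; last by lia.
  apply/eqP; rewrite eqn_leq le_k1 leqNgt; apply/negP => lt_k1.
  have := bin_tailS n k1.+1; have : 0 < 'C(n, k1.+1) by rewrite bin_gt0.
  lia.
rewrite y0 eq_k1 /nbhd_bound shadow0 addn0 bin_tailS binn bin_tail_small //.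
rewrite addn0 (maxn_idPr gt0).
by apply: sub_count => t /= ->; rewrite orbT.
Qed.

(** At [k = uphalf n] this makes [nbhd_bound n k z] exceed the vertex count [bin_tail n k.+1 + z] by
    exactly [harper_sum n]. Passing to [n.+1] keeps [z] for odd [n] and adds ['C(n, n./2.+1)] for
    even [n]. *)
Lemma harper_sum_attained n : exists z,
  [/\ 0 < z, z <= 'C(n, uphalf n) &
      'C(n, uphalf n) + shadow n (uphalf n) z = z + harper_sum n].
Proof.
elim: n => [|n [z [z_gt0 le_z eq_z]]]; first by exists 1; rewrite /harper_sum big_ord0.
have -> : harper_sum n.+1 = harper_sum n + 'C(n, n./2) by rewrite /harper_sum big_ord_recr.
have -> : uphalf n.+1 = n./2.+1 by [].
move: le_z eq_z; rewrite uphalf_half; case: (odd n); rewrite ?add1n ?add0n => le_z eq_z.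
  by exists z; rewrite shadow_left // binS; split; lia.
exists ('C(n, n./2.+1) + z); rewrite shadow_right // binS.
by split; lia.
Qed.

(** * Bandwidth bounds from labellings *)

Lemma bandwidth_le (T : finType) (e : rel T) (w : T -> nat) (m : nat) :
    injective w -> (forall x y, e x y -> w x <= w y + m /\ w y <= w x + m) ->
  bandwidth e <= m.
Proof.
move=> inj_w adj_w; pose r x := #|[pred z | w z < w x]|.
have r_lt x : r x < #|T|.
  apply/proper_card/properP; split; first exact/subsetP.
  by exists x; rewrite // inE ltnn.
have r_mono x y : w x < w y -> r x < r y.
  move=> lt_xy; apply/proper_card/properP; split.
    by apply/subsetP => z; rewrite !inE => /ltn_trans; apply.
  by exists x; rewrite !inE ?ltnn.
have inj_r : injective r.
  move=> x y eq_r.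
  by case: (ltngtP (w x) (w y)) => [/r_mono|/r_mono|/inj_w//];
    rewrite eq_r ltnn.
have r_le x y : w x <= w y + m -> r x <= r y + m.
  (* The vertices ranked below [x] but not below [y] have distinct labels in an interval of length
     at most [m]. *)
  move=> le_xy; pose D := [pred z | w y <= w z < w x].
  have le_D : #|D| <= m.
    rewrite -(size_iota (w y) m) cardE -(size_map w) uniq_leq_size //.
      by rewrite map_inj_uniq ?enum_uniq.
    move=> _ /mapP[z + ->]; rewrite mem_enum mem_iota inE => /andP[-> lt_z].
    exact: leq_trans lt_z le_xy.
  rewrite (leq_trans _ (leq_add (leqnn _) le_D)) // /r -cardUI.
  rewrite (leq_trans _ (leq_addr _ _)) // subset_leq_card //.
  by apply/subsetP => z; rewrite !inE => ->; rewrite andbT ltnNge orNb.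
pose eta := [ffun x => Ordinal (r_lt x)].
have num_eta : numbering eta.
  by apply/injectiveP => x y; rewrite !ffunE => /(congr1 val) /inj_r.
apply: leq_trans ((bandwidthP e).2 eta num_eta) _.
apply/bigmax_leqP => -[x y] /= /adj_w[/r_le le_xy /r_le le_yx].
rewrite !ffunE /=; lia.
Qed.

Lemma hypercubeP n (S S' : {set 'I_n}) : hypercube S S' ->
  exists i, (i \notin S /\ S' = i |: S) \/ (i \notin S' /\ S = i |: S').
Proof.
move=> /cards1P[i /setP eq_i]; exists i.
have [iS|iS] := boolP (i \in S); [right|left]; split=> //.
- by have := eq_i i; rewrite !inE eqxx iS; case: (i \in S').
- apply/setP => j; have := eq_i j; rewrite !inE; have [->|_] := eqVneq j i.
    by rewrite iS.
  by case: (j \in S); case: (j \in S').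
- apply/setP => j; have := eq_i j; rewrite !inE; have [->|_] := eqVneq j i.
    by rewrite (negPf iS); case: (i \in S').
  by case: (j \in S); case: (j \in S').
Qed.

Lemma hypercube_bandwidth_le n (w : {set 'I_n} -> nat) (m : nat) :
    injective w ->
    (forall i (S : {set 'I_n}), i \notin S ->
       w S <= w (i |: S) + m /\ w (i |: S) <= w S + m) ->
  bandwidth (@hypercube n) <= m.
Proof.
move=> inj_w adj_w; apply: bandwidth_le inj_w _ => S S' /hypercubeP[i].
by case=> -[iS ->]; have [] := adj_w _ _ iS.
Qed.

Lemma hypercube_bandwidth_le_weight n (a : 'I_n -> nat) (m : nat) :
    injective (fun S : {set 'I_n} => \sum_(i in S) a i) ->
    (forall i, a i <= m) ->
  bandwidth (@hypercube n) <= m.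
Proof.
move=> inj_a le_a; apply: hypercube_bandwidth_le inj_a _ => i S iS.
by rewrite big_setU1 //=; have := le_a i; lia.
Qed.

Lemma leq_bin_half n k : 'C(n, k) <= 'C(n, n./2).
Proof.
have up d : 'C(n, n./2 - d) <= 'C(n, n./2).
  elim: d => [|d IHd]; first by rewrite subn0.
  have [le_d|lt_d] := leqP n./2 d.
    by move: IHd; rewrite (eqP (leqW le_d : n./2 - d.+1 == 0)) (eqP (le_d : n./2 - d == 0)).
  apply: leq_trans IHd; rewrite -(subnSK lt_d) -(leq_pmul2l (ltn0Sn (n./2 - d.+1))).
  by rewrite mul_bin_left leq_mul2r; lia.
have [le_k|lt_k] := leqP k n./2; first by rewrite -(subKn le_k).
have [le_kn|lt_nk] := leqP k n; last by rewrite bin_small.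
by rewrite -bin_sub // -(subKn (_ : n - k <= n./2)) //; lia.
Qed.

(** * The bandwidth of the hypercube *)

(** A numbering that puts larger sets first. Bits are indexed by [nat] so that inductions on [n] can
    use prefixes of one sequence. *)
Definition harper_rank n (b : nat -> bool) : nat :=
  \sum_(m < n) bin_tail m (\sum_(i < m.+1) b i).

Lemma harper_rankS n (b : nat -> bool) :
  harper_rank n.+1 b = harper_rank n b + bin_tail n (\sum_(i < n.+1) b i).
Proof. by rewrite /harper_rank big_ord_recr. Qed.

(** These intervals are disjoint for different cardinalities, so the rank determines the
    cardinality. *)
Lemma harper_rank_bounds n (b : nat -> bool) :
  bin_tail n (\sum_(i < n) b i).+1 <= harper_rank n b < bin_tail n (\sum_(i < n) b i).
Proof.
elim: n => [|n]; first by rewrite /harper_rank !big_ord0 bin_tail_small // bin_tail0.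
rewrite harper_rankS big_ord_recr /=; move: (harper_rank n b) (\sum_(i < n) b i) => r c IHn.
case: (b n); rewrite /= ?addn1 ?addn0 bin_tail_pascal.
  by have := leq_bin_tail n _ _ (leqnSn c.+1); rewrite (bin_tail_pascal n c); lia.
case: c IHn => [|c]; last first.
  by have := leq_bin_tail n _ _ (leqnSn c); rewrite (bin_tail_pascal n c); lia.
by rewrite !bin_tail0 expnS; lia.
Qed.

(** Equal ranks give equal cardinalities, hence equal last summands; induction then yields all bits
    but the last, which the cardinality fixes. *)
Lemma harper_rank_inj n (b c : nat -> bool) : harper_rank n b = harper_rank n c ->
  forall i, i < n -> b i = c i.
Proof.
elim: n => [//|n IHn] eq_bc.
have eq_sum : \sum_(i < n.+1) b i = \sum_(i < n.+1) c i.
  have := harper_rank_bounds n.+1 c; have := harper_rank_bounds n.+1 b; rewrite eq_bc.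
  case: (ltngtP (\sum_(i < n.+1) b i) (\sum_(i < n.+1) c i)) => // lt.
    by have := leq_bin_tail n.+1 _ _ lt; lia.
  by have := leq_bin_tail n.+1 _ _ lt; lia.
have {}eq_bc : harper_rank n b = harper_rank n c.
  by move: eq_bc; rewrite !harper_rankS eq_sum => /addIn.
have {}IHn := IHn eq_bc.
move=> i; rewrite ltnS leq_eqVlt => /predU1P[->|/IHn//].
move: eq_sum; rewrite !big_ord_recr /= (eq_bigr (fun i : 'I_n => c i : nat)).
  by move/addnI; case: (b n); case: (c n).
by move=> j _; rewrite IHn.
Qed.

Definition bit_vector n (S : {set 'I_n}) (i : nat) : bool :=
  oapp (mem S) false (insub i).

Lemma bit_vectorE n (S : {set 'I_n}) (i : 'I_n) : bit_vector n S i = (i \in S).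
Proof. by rewrite /bit_vector valK. Qed.

Lemma bandwidth_hypercube_le n : bandwidth (@hypercube n) <= harper_sum n.
Proof.
apply: (@hypercube_bandwidth_le n (fun S => harper_rank n (bit_vector n S))).
  move=> S S' /harper_rank_inj eqSS'; apply/setP => i.
  by rewrite -!bit_vectorE eqSS'.
move=> i S iS; have bitU j : bit_vector n (i |: S) j = (j == i) || bit_vector n S j.
  rewrite /bit_vector; case: insubP => [u _ <-|] /=; first by rewrite !inE.
  by rewrite orbF; have [->|//] := eqVneq j i; rewrite ltn_ord.
have sumU m :
    \sum_(j < m) bit_vector n (i |: S) j = (i < m) + \sum_(j < m) bit_vector n S j.
  elim: m => [|m IHm]; first by rewrite !big_ord0.
  rewrite !big_ord_recr /= IHm bitU ltnS; case: (ltngtP m i) => [||->] //=.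
  by rewrite bit_vectorE (negPf iS); lia.
suff step m : bin_tail m (\sum_(j < m.+1) bit_vector n (i |: S) j)
      <= bin_tail m (\sum_(j < m.+1) bit_vector n S j)
      <= bin_tail m (\sum_(j < m.+1) bit_vector n (i |: S) j) + 'C(m, m./2).
  split; last first.
    by rewrite (leq_trans _ (leq_addr _ _)) // leq_sum // => j _; case/andP: (step j).
  by rewrite -big_split leq_sum // => j _; case/andP: (step j).
rewrite sumU; set c := \sum_(j < _) _.
rewrite leq_bin_tail ?leq_addl //=; case: (i < _); last by rewrite leq_addr.
by rewrite bin_tailS addnC leq_add2l leq_bin_half.
Qed.

(** * From bit vectors to vertex sets, and the lower bound *)

Lemma card_set_ord n : #|{set 'I_n}| = 2 ^ n.
Proof. by rewrite -cardsT -powersetT card_powerset cardsT card_ord. Qed.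

Lemma mem_cube n s : (s \in cube n) = (size s == n).
Proof.
elim: n s => [|n IHn] [|b s] //=.
  by rewrite mem_cat; apply/negbTE; rewrite negb_or; apply/andP; split; apply/mapP => -[].
rewrite eqSS -IHn mem_cat; apply/orP/idP => [[]/mapP[t ct [_ ->]] //|cs].
by case: b; [right|left]; apply: map_f.
Qed.

Lemma uniq_cube n : uniq (cube n).
Proof.
elim: n => [//|n IHn] /=.
have inj_cons b : injective (cons b : bitseq -> bitseq) by move=> s t [].
rewrite cat_uniq !map_inj_uniq // IHn andbT.
by apply/hasPn => _ /mapP[t _ ->]; apply/mapP => -[].
Qed.

Definition bit_set n (s : bitseq) : {set 'I_n} := [set i : 'I_n | nth false s i].

Lemma count_cube n (p : pred {set 'I_n}) :
  count (fun s => p (bit_set n s)) (cube n) = #|p|.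
Proof.
have inj_set : {in cube n &, injective (bit_set n)}.
  move=> s t; rewrite !mem_cube => /eqP size_s /eqP size_t /setP eq_st.
  apply: (@eq_from_nth _ false) => [|i]; first by rewrite size_t.
  by rewrite size_s => lt_in; have := eq_st (Ordinal lt_in); rewrite !inE.
have uniq_set : uniq (map (bit_set n) (cube n)) by rewrite map_inj_in_uniq ?uniq_cube.
have mem_set : map (bit_set n) (cube n) =i {set 'I_n}.
  apply/subset_cardP; last exact/subsetP.
  by rewrite (card_uniqP uniq_set) size_map size_cube card_set_ord.
rewrite -(count_map (bit_set n)) cardE -size_filter; apply/perm_size/uniq_perm.
- exact: filter_uniq.
- exact: enum_uniq.
- by move=> S; rewrite mem_filter mem_set mem_enum andbT.
Qed.

Lemma nbhdP (P : pred bitseq) s : nbhd P s ->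
  P s \/ exists2 i, i < size s & P (set_nth false s i (~~ nth false s i)).
Proof.
elim: s P => [|b s IHs] P /=; first by left.
case/orP => [/IHs[|[i lt_i Pi]]|Pb]; [by left| |].
- by right; exists i.+1.
- by right; exists 0.
Qed.

Lemma hypercube_set_nth n s i : i < n ->
  hypercube (bit_set n s) (bit_set n (set_nth false s i (~~ nth false s i))).
Proof.
move=> lt_in; apply/cards1P; exists (Ordinal lt_in); apply/setP => j.
rewrite !inE nth_set_nth /= -val_eqE /=; case: (eqVneq (val j) i) => [->|_].
  by case: (nth _ _ _).
by case: (nth _ _ _).
Qed.

Lemma card_numbering_lt (T : finType) (eta : {ffun T -> 'I_#|T|}) k :
  numbering eta -> k <= #|T| -> #|[pred x | eta x < k]| = k.
Proof.
move=> /numberingP[g gK Kg] le_k.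
rewrite -[RHS]card_ord -(card_image (f := g \o widen_ord le_k)).
  apply: eq_card => x; rewrite inE; apply/idP/imageP => [lt_x|[j _ ->]].
    by exists (Ordinal lt_x) => //=; rewrite -[LHS]gK; congr g; apply: val_inj.
  by rewrite /= Kg /= ltn_ord.
by apply: inj_comp (can_inj Kg) _ => j1 j2 /(congr1 val) /= /val_inj.
Qed.

Lemma leq_numbering_bandwidth (T : finType) (e : rel T) (eta : {ffun T -> 'I_#|T|}) x y :
  e x y -> eta y <= eta x + numbering_bandwidth e eta /\
           eta x <= eta y + numbering_bandwidth e eta.
Proof.
move=> e_xy; have := leq_bigmax_cond (P := fun p : T * T => e p.1 p.2)
  (F := fun p => `|eta p.1 - eta p.2|%N) (x, y) e_xy.
by rewrite /numbering_bandwidth /=; lia.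
Qed.

Lemma bandwidth_hypercube_ge n : 0 < n -> harper_sum n <= bandwidth (@hypercube n).
Proof.
move=> n_gt0; have [[eta num_eta ->] _] := bandwidthP (@hypercube n).
have [z [z_gt0 le_z eq_z]] := harper_sum_attained n.
have le_un : uphalf n <= n by lia.
have cardT : #|{set 'I_n}| = 2 ^ n by rewrite card_set_ord.
pose P j (s : bitseq) := eta (bit_set n s) < j.
have countP j : j <= 2 ^ n -> count (P j) (cube n) = j.
  by move=> le_j; rewrite (count_cube n [pred S | eta S < j]) card_numbering_lt ?cardT.
set k := bin_tail n (uphalf n).+1 + z.
have le_k : k <= 2 ^ n.
  by rewrite -bin_tail0 (leq_trans _ (leq_bin_tail n _ _ (leq0n (uphalf n)))) // bin_tailS; lia.
have := @cube_isoperimetry n (P k) _ z le_un le_z; rewrite countP //.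
have k_gt0 : 0 < k by rewrite /k; lia.
rewrite /nbhd_bound (bin_tailS n (uphalf n)) => /(_ k_gt0 erefl) le_nbhd.
have {le_nbhd} : k + harper_sum n <= count (nbhd (P k)) (cube n).
  by rewrite /k in le_nbhd *; lia.
have H_gt0 : 0 < harper_sum n.
  by case: (n) n_gt0 => // m _; rewrite /harper_sum big_ord_recl.
(* Labels start at 0, so [k + harper_sum n] vertices cannot all have labels below
   [(k + harper_sum n).-1]. A vertex [s] reaching this value has a neighbour with label at most
   [k.-1]. *)
have [/hasP[s cube_s /andP[nbhd_s /= ge_s]] _|/hasPn none] :=
  boolP (has (predI (nbhd (P k)) (predC (P (k + harper_sum n).-1))) (cube n)); last first.
  have le_count : count (nbhd (P k)) (cube n) <= count (P (k + harper_sum n).-1) (cube n).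
    rewrite (eq_in_count (a2 := predI (nbhd (P k)) (P (k + harper_sum n).-1))).
      by apply: sub_count => s /andP[].
    by move=> s /none /=; rewrite negb_and negbK; case: nbhd.
  have := count_size (nbhd (P k)) (cube n); rewrite size_cube.
  move=> le1 le2; move: le_count; rewrite countP; lia.
have [Ps|[i lt_i Pt]] := nbhdP _ _ nbhd_s; first by move: ge_s Ps; rewrite /P; lia.
move: lt_i; have:= cube_s; rewrite mem_cube => /eqP-> lt_i.
have adj := hypercube_set_nth n s i lt_i.
have [_] := leq_numbering_bandwidth _ _ eta _ _ adj.
move: ge_s Pt; rewrite /P /=; lia.
Qed.

Theorem proposition2p2 (n : nat) (hn : 1 <= n) :
  (forall a : nat -> nat,
     0 < a 1 ->
     (forall i j : nat, 1 <= i -> i < j -> j <= n -> a i < a j) ->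
     injective (fun S : {set 'I_n} => \sum_(i in S) a i.+1) ->
     bandwidth (@hypercube n) <= a n)
  /\ bandwidth (@hypercube n) <= dss_min_max n
  /\ bandwidth (@hypercube n) = harper_sum n.
Proof.
split=> [a _ lt_a inj_a|].
  apply: hypercube_bandwidth_le_weight inj_a _ => i.
  have := ltn_ord i; rewrite leq_eqVlt => /predU1P[->//|lt_in].
  by apply/ltnW/lt_a.
split; last first.
  by apply/eqP; rewrite eqn_leq bandwidth_hypercube_le bandwidth_hypercube_ge.
rewrite /dss_min_max; case: ex_minnP => m /existsP[A].
case/and4P=> /eqP cardA _ /dinjectiveP inj_A _ _.
(* The elements of [A] serve as weights; their type already bounds them by [m]. *)
pose f (i : 'I_n) : 'I_m.+1 := enum_val (cast_ord (esym cardA) i).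
have inj_f : injective f by move=> i j /enum_val_inj /cast_ord_inj.
apply: (@hypercube_bandwidth_le_weight n (fun i => f i)) => [S S' eqSS'|i]; last by rewrite -ltnS.
apply: (imset_inj inj_f); apply: inj_A.
- by rewrite powersetE; apply/subsetP => _ /imsetP[i _ ->]; apply: enum_valP.
- by rewrite powersetE; apply/subsetP => _ /imsetP[i _ ->]; apply: enum_valP.
- by rewrite !big_imset => [//|? ? _ _ /inj_f|? ? _ _ /inj_f].
Qed.
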